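(* Assume that $\Gamma(X)^T\Gamma(X)$ is almost surely invertible. Let $m\le Cn$ for some constant $C$ and assume that $f\in L^p(\Omega)$ and $K_q(\Gamma)<+\infty$ for some $p\in[1,+\infty]$ and with $q^{-1}+p^{-1}=1$. Then there exists a constant $C(n)$, depending on $n$ (and on $C$ and $K_q(\Gamma)$) but not on $f$, such that $$\mathbb{E}\,\|\beta\|_2\le C(n)\,\|f\|_{L^p(\Omega)}.$$
   Context: $(\Omega,\mu)$ is a probability space, $n,m\ge1$ are integers, and $f,\gamma_1,\dots,\gamma_n:\Omega\to\mathbb{R}$ are measurable functions. $X=(X^{(1)},\dots,X^{(m)})$ where $X^{(1)},\dots,X^{(m)}$ are i.i.d. random points of $\Omega$ with distribution $\mu$. $F(X)=(f(X^{(1)}),\dots,f(X^{(m)}))^T\in\mathbb{R}^m$, and $\Gamma(X)$ is the random $m\times n$ matrix with entries $\Gamma_{ij}(X)=\gamma_j(X^{(i)})$. The random vector $\beta\in\mathbb{R}^n$ is $\beta=(\Gamma(X)^T\Gamma(X))^{-1}\Gamma(X)^TF(X)$. $s_1(\Gamma(X))$ is the smallest eigenvalue of $\Gamma(X)^T\Gamma(X)$. For $q\in[1,\infty)$, $K_q(\Gamma)=\big[\mathbb{E}\,(s_1(\Gamma(X))^{-q/2})\big]^{2/q}$, and $K_\infty(\Gamma)=\|s_1(\Gamma(X))^{-1}\|_{L^\infty}$. $\|\cdot\|_2$ is the Euclidean norm. *)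

(* Defs.v *)
From HB Require Import structures.
From mathcomp Require Import all_boot all_order all_algebra.
From mathcomp Require Import all_classical all_reals all_analysis.

Set Implicit Arguments.
Unset Strict Implicit.
Unset Printing Implicit Defensive.

Import Order.TTheory GRing.Theory Num.Theory.
Import numFieldNormedType.Exports.

Local Open Scope classical_set_scope.
Local Open Scope ring_scope.
Local Open Scope ereal_scope.

(* For a finite family of random variables the product rule over the whole
   index set gives the one over every subfamily, by taking [A i := setT]. *)
Definition mutually_independent (R : realType) (d d' : measure_display)
    (T : measurableType d) (T' : measurableType d') (P : probability T R)
    (m : nat) (X : 'I_m -> {RV P >-> T'}) : Prop :=
  forall A : 'I_m -> set T', (forall i, measurable (A i)) ->
    P (\bigcap_i (X i @^-1` A i)) = \prod_(i < m) P (X i @^-1` A i).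

Definition iid (R : realType) (d d' : measure_display)
    (T : measurableType d) (T' : measurableType d') (P : probability T R)
    (mu : probability T' R) (m : nat) (X : 'I_m -> {RV P >-> T'}) : Prop :=
  mutually_independent X /\
  forall i (A : set T'), measurable A -> distribution P (X i) A = mu A.

Section sampled_least_squares.
Context (R : realType) (T Omega : Type) (m n : nat).
Variables (f : Omega -> R) (gamma : 'I_n -> Omega -> R) (X : 'I_m -> T -> Omega).

Definition sampleF (w : T) : 'cV[R]_m := (\col_i f (X i w))%R.

Definition sampleGamma (w : T) : 'M[R]_(m, n) :=
  (\matrix_(i, j) gamma j (X i w))%R.

Definition gram (w : T) : 'M[R]_n :=
  ((sampleGamma w)^T *m sampleGamma w)%R.

Definition beta (w : T) : 'cV[R]_n :=
  (invmx (gram w) *m (sampleGamma w)^T *m sampleF w)%R.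

End sampled_least_squares.

Definition euclidean_norm (R : realType) (n : nat) (v : 'cV[R]_n) : R :=
  Num.sqrt (\sum_i v i ord0 ^+ 2)%R.

(* The infimum is a minimum as soon as there is a real eigenvalue, the set of
   eigenvalues being finite; this is the case for symmetric [M] and [0 < n]. *)
Definition smallest_eigenvalue (R : realType) (n : nat) (M : 'M[R]_n) : R :=
  inf [set a : R | eigenvalue M a].

Definition s1 (R : realType) (T Omega : Type) (m n : nat)
    (gamma : 'I_n -> Omega -> R) (X : 'I_m -> T -> Omega) (w : T) : R :=
  smallest_eigenvalue (gram gamma X w).

(* The inverse is taken in [\bar R], where [0^-1 = +oo]; in [R] one would have
   [0 `^ (- r / 2) = 0].  The [-oo] branch is a junk value. *)
Definition K (R : realType) (d : measure_display) (T : measurableType d)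
    (Omega : Type) (P : probability T R) (m n : nat) (q : \bar R)
    (gamma : 'I_n -> Omega -> R) (X : 'I_m -> T -> Omega) : \bar R :=
  match q with
  | r%:E => (\int[P]_w ((s1 gamma X w)%:E^-1 `^ (r / 2))) `^ (2 / r)
  | +oo => 'N[P]_(+oo)[(fun w => (s1 gamma X w)%:E^-1)]
  | -oo => 0
  end.

(* Main.v *)
Require Import Defs.
From mathcomp Require Import all_boot all_order all_algebra.
From mathcomp Require Import all_classical all_reals all_analysis.
From mathcomp Require Import measurable_realfun measurable_fun_approximation ess_sup_inf hoelder.
From mathcomp Require Import ring lra.

(** Write [A] for the sampled matrix and [F] for the vector of sampled values.
    Pointwise, the statement is the classical stability estimate of least squares:
    where the Gram matrix is invertible, [A beta] is the orthogonal projection of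
    [F] on the range of [A], and the Rayleigh bound ([smallest_eigenvalueP]) gives
    [s1 |beta|^2 <= |A beta|^2 <= |F|^2] ([normal_equation_bound]), that is
    [|beta| <= s1^(-1/2) |F|].

    Bounding [|F|] by the sum of the [|f(X_i)|] and applying Hoelder's inequality
    to each product [s1^(-1/2) |f(X_i)|] bounds the expectation of [|beta|] by
    [m] times [K_q^(1/2) |f|_p], since [K_q^(1/2)] is the Lq norm of [s1^(-1/2)]
    and every [X_i] has law [mu].  As [m <= C n], one may take
    [c n C k = C n sqrt k].

    Hoelder's inequality requires measurable factors, and the measurability of
    the smallest eigenvalue is not immediate.  It is avoided by using, instead of
    [s1^(-1/2)], the ratio [|beta| / |F|] ([gain]): Cramer's rule makes it
    measurable, [|beta| = gain * |F|] almost surely ([gainE]), and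
    [gain^2 <= s1^-1] everywhere ([sqr_gain_le]).  The passage from [gain] to [K_q]
    then only compares integrals of nonnegative functions, which is legitimate
    without measurability ([ae_ge0_le_inner_integral]). *)

Set Implicit Arguments.
Unset Strict Implicit.
Unset Printing Implicit Defensive.

Import Order.TTheory GRing.Theory Num.Theory.
Import numFieldNormedType.Exports.
Local Open Scope classical_set_scope.
Local Open Scope ring_scope.
Local Open Scope ereal_scope.

(** * The Rayleigh bound for the smallest eigenvalue of a symmetric matrix *)

Section Rayleigh.
Context (R : realType).
Local Open Scope ring_scope.

Definition dot n (u v : 'rV[R]_n) : R := (u *m v^T) ord0 ord0.

Lemma dotE n (u v : 'rV[R]_n) : dot u v = \sum_i u ord0 i * v ord0 i.
Proof. by rewrite /dot mxE; apply: eq_bigr => i _; rewrite mxE. Qed.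

Lemma dotC n (u v : 'rV[R]_n) : dot u v = dot v u.
Proof. by rewrite !dotE; apply: eq_bigr => i _; rewrite mulrC. Qed.

Lemma dotDl n (u v w : 'rV[R]_n) : dot (u + v) w = dot u w + dot v w.
Proof. by rewrite /dot mulmxDl mxE. Qed.

Lemma dotZl n a (u v : 'rV[R]_n) : dot (a *: u) v = a * dot u v.
Proof. by rewrite /dot -scalemxAl mxE. Qed.

Lemma dotDr n (u v w : 'rV[R]_n) : dot w (u + v) = dot w u + dot w v.
Proof. by rewrite dotC dotDl !(dotC w). Qed.

Lemma dotZr n a (u v : 'rV[R]_n) : dot v (a *: u) = a * dot v u.
Proof. by rewrite dotC dotZl dotC. Qed.

Lemma dot_ge0 n (u : 'rV[R]_n) : 0 <= dot u u.
Proof. by rewrite dotE sumr_ge0// => i _; rewrite -expr2 sqr_ge0. Qed.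

Lemma dot_eq0 n (u : 'rV[R]_n) : (dot u u == 0) = (u == 0).
Proof.
apply/eqP/eqP => [|->]; last by rewrite /dot mul0mx mxE.
rewrite dotE => /eqP; rewrite psumr_eq0; last first.
  by move=> i _; rewrite -expr2 sqr_ge0.
move=> /allP u0; apply/rowP => i; rewrite mxE; apply/eqP.
by rewrite -sqrf_eq0 expr2; apply: (u0 i); rewrite mem_index_enum.
Qed.

Lemma dot_mulmx_adj m n (M : 'M[R]_(m, n)) u v : dot (u *m M) v = dot u (v *m M^T).
Proof. by rewrite /dot trmx_mul trmxK mulmxA. Qed.

Lemma continuous_quadratic_form n (M : 'M[R]_n) :
  continuous (fun v : 'rV[R]_n => dot (v *m M) v).
Proof.
rewrite (_ : (fun _ => _) = fun v : 'rV[R]_n =>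
    \sum_i (\sum_j v ord0 j * M j i) * v ord0 i); last first.
  by apply/funext => v; rewrite dotE; apply: eq_bigr => i _; rewrite mxE.
have cX i : continuous (fun v : 'rV[R]_n => v ord0 i : R).
  exact: coord_continuous.
have cM i : continuous (fun v : 'rV[R]_n => \sum_j v ord0 j * M j i).
  apply: continuous_big => [|j _ v]; first exact: add_continuous.
  apply: (@continuousM R _ (fun v : 'rV[R]_n => v ord0 j) (fun=> M j i)).
    exact: cX.
  exact: cst_continuous.
apply: continuous_big => [|i _ v]; first exact: add_continuous.
apply: (@continuousM R _ (fun v : 'rV[R]_n => \sum_j v ord0 j * M j i)
  (fun v : 'rV[R]_n => v ord0 i)); [exact: cM|exact: cX].
Qed.

Lemma compact_unit_sphere n : compact [set v : 'rV[R]_n | dot v v = 1].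
Proof.
apply: bounded_closed_compact.
  exists 1; split => // r r1 v /= v1; apply/(le_trans _ (ltW r1)).
  rewrite [leLHS]mx_normrE; apply: bigmax_le => //= -[i j] _ /=.
  rewrite (ord1 i) -(@expr_le1 _ 2)// real_normK ?num_real// -v1 dotE.
  rewrite (bigD1 j)//= -expr2 lerDl sumr_ge0// => k _.
  by rewrite -expr2 sqr_ge0.
apply: (@closed_comp _ _ (fun v : 'rV[R]_n => dot v v) [set 1]).
  move=> v _; have := @continuous_quadratic_form n 1%:M v.
  by under eq_fun do rewrite mulmx1.
exact: closed_eq.
Qed.

(** The Rayleigh quotient attains its minimum on the compact unit sphere, and
    homogeneity of degree two extends the resulting bound to all vectors.
    For [n = 0] the sphere is empty. *)
Lemma exists_rayleigh_minimizer n (M : 'M[R]_n) : (0 < n)%N ->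
  exists2 u : 'rV[R]_n, dot u u = 1 &
    forall v, dot (u *m M) u * dot v v <= dot (v *m M) v.
Proof.
case: n M => // n M _.
have [|||u] := @EVT_min_rV R n.+1 (fun v => dot (v *m M) v)
    [set v : 'rV[R]_n.+1 | dot v v = 1].
- exists (delta_mx 0 0); rewrite /= dotE (bigD1 0)//= big1 ?addr0.
    by rewrite !mxE eqxx mulr1.
  by move=> i i0; rewrite !mxE/= (negbTE i0) mulr0.
- exact: compact_unit_sphere.
- by apply: continuous_subspaceT; exact: continuous_quadratic_form.
rewrite inE /= => u1 umin; exists u => // v.
have [->|v0] := eqVneq v 0; first by rewrite mul0mx /dot !mul0mx !mxE mulr0.
have vv0 : 0 < dot v v by rewrite lt_def dot_ge0 dot_eq0 v0.
pose c := (Num.sqrt (dot v v))^-1.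
have c2 : c * c * dot v v = 1.
  by rewrite /c -expr2 exprVn sqr_sqrtr ?ltW// mulVf// gt_eqF.
have := umin (c *: v).
rewrite inE /= dotZl dotZr mulrA c2 -scalemxAl dotZl dotZr mulrA => /(_ erefl).
have -> : c * c = (dot v v)^-1.
  by apply: (mulIf (lt0r_neq0 vv0)); rewrite c2 mulVf// gt_eqF.
by rewrite mulrC ler_pdivlMr.
Qed.

(** First-order optimality: with [w = u M], the form takes the value
    [2 t |w|^2 + O(t^2)] at [u + t w], which is negative for small [t < 0]
    unless [w = 0]. *)
Lemma psd_isotropic_ker n (M : 'M[R]_n) (u : 'rV[R]_n) : M^T = M ->
  (forall v, 0 <= dot (v *m M) v) -> dot (u *m M) u = 0 -> u *m M = 0.
Proof.
move=> Msym Mpsd Mu; set w := u *m M.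
apply/eqP; rewrite -dot_eq0; apply/contraT => w0.
have ww : 0 < dot w w by rewrite lt_def w0 dot_ge0.
set c := dot (w *m M) w.
have c0 : 0 <= c by exact: Mpsd.
have c1 : 0 < c + 1 by lra.
(* close to the minimizer of [2 t |w|^2 + t^2 c]; the shift [c + 1] keeps the
   denominator positive when [c = 0] *)
pose t := - (dot w w / (c + 1)).
have := Mpsd (u + t *: w).
rewrite mulmxDl -scalemxAl !dotDl !dotDr !dotZl !dotZr Mu -/c -/w.
have -> : dot (w *m M) u = dot w w by rewrite dot_mulmx_adj Msym.
set e := dot w w in ww t *.
have et : e = - t * (c + 1) by rewrite /t opprK divfK// gt_eqF.
have t0 : t < 0 by rewrite /t oppr_lt0 divr_gt0.
have tc : 0 < t * t * (c + 2) by rewrite mulr_gt0 ?nmulr_lgt0//; lra.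
rewrite et leNgt => /negP[]; rewrite -subr_gt0.
by apply: lt_le_trans tc _; rewrite le_eqVlt; apply/orP; left; apply/eqP; ring.
Qed.

(** The minimum [l] of the Rayleigh quotient is an eigenvalue, because its
    minimizer is isotropic for the positive semidefinite form of [M - l]; and
    every eigenvalue is a value of the quotient, so [l] is the least one. *)
Lemma smallest_eigenvalueP n (M : 'M[R]_n) : (0 < n)%N -> M^T = M ->
  eigenvalue M (smallest_eigenvalue M) /\
  forall v, smallest_eigenvalue M * dot v v <= dot (v *m M) v.
Proof.
move=> n0 Msym; have [u u1 umin] := exists_rayleigh_minimizer M n0.
set l := dot (u *m M) u in umin.
have uM : u *m (M - l%:M) = 0.
  apply: psd_isotropic_ker => [|v|].
  - by rewrite linearB /= Msym tr_scalar_mx.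
  - by rewrite mulmxBr mul_mx_scalar -scaleN1r dotDl !dotZl mulN1r subr_ge0.
  - by rewrite mulmxBr mul_mx_scalar -scaleN1r dotDl !dotZl u1 /l; ring.
have el : eigenvalue M l.
  apply/eigenvalueP; exists u; last by rewrite -dot_eq0 u1 oner_eq0.
  by apply/eqP; rewrite -subr_eq0 -mul_mx_scalar -mulmxBr uM.
suff -> : smallest_eigenvalue M = l by [].
have lbl : lbound [set a | eigenvalue M a] l.
  move=> a /eigenvalueP[v vM v0]; have := umin v.
  rewrite vM dotZl ler_pM2r// lt_def dot_ge0 dot_eq0.
  by rewrite v0.
apply/eqP; rewrite eq_le; apply/andP; split.
  by apply: ge_inf => //; exists l.
by apply: lb_le_inf => //; exists l.
Qed.

End Rayleigh.

(** * The deterministic least squares estimate *)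

Section LeastSquares.
Context (R : realType).
Local Open Scope ring_scope.

Lemma sqr_euclidean_norm n (v : 'cV[R]_n) :
  euclidean_norm v ^+ 2 = dot v^T v^T.
Proof.
rewrite sqr_sqrtr ?sumr_ge0// => [|i _]; last exact: sqr_ge0.
by rewrite dotE; apply: eq_bigr => i _; rewrite mxE expr2.
Qed.

Lemma euclidean_norm_ge0 n (v : 'cV[R]_n) : 0 <= euclidean_norm v.
Proof. exact: sqrtr_ge0. Qed.

Lemma euclidean_norm_eq0 n (v : 'cV[R]_n) : (euclidean_norm v == 0) = (v == 0).
Proof. by rewrite -sqrf_eq0 sqr_euclidean_norm dot_eq0 trmx_eq0. Qed.

Lemma euclidean_norm_le_sum n (v : 'cV[R]_n) :
  euclidean_norm v <= \sum_i `|v i ord0|.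
Proof.
rewrite -(@ler_pXn2r _ 2)// ?nnegrE ?sumr_ge0// ?sqrtr_ge0//.
rewrite sqr_sqrtr ?sumr_ge0// => [|i _]; last exact: sqr_ge0.
rewrite expr2 mulr_suml ler_sum// => i _; rewrite -real_normK ?num_real// expr2.
by rewrite ler_wpM2l// (bigD1 i)//= lerDl sumr_ge0.
Qed.

Lemma gram_eigenvalue_ge0 m n (A : 'M[R]_(m, n)) : (0 < n)%N ->
  0 <= smallest_eigenvalue (A^T *m A).
Proof.
move=> n0; have [|/eigenvalueP[v vG v0] _] := @smallest_eigenvalueP R n (A^T *m A) n0.
  by rewrite trmx_mul trmxK.
have v1 : 0 < dot v v by rewrite lt_def dot_ge0 dot_eq0 v0.
by rewrite -(pmulr_lge0 _ v1) -dotZl -vG mulmxA dot_mulmx_adj dot_ge0.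
Qed.

(** By the Rayleigh bound the left-hand side is at most [|A b|^2].  As [b] solves
    the normal equations, [A b] is the orthogonal projection of [F] on the range
    of [A], so it is no longer than [F]. *)
Lemma normal_equation_bound m n (A : 'M[R]_(m, n)) (b : 'cV_n) (F : 'cV_m) :
  (0 < n)%N -> A^T *m A *m b = A^T *m F ->
  smallest_eigenvalue (A^T *m A) * euclidean_norm b ^+ 2 <= euclidean_norm F ^+ 2.
Proof.
move=> n0 bF; rewrite !sqr_euclidean_norm.
have [|_ /(_ b^T)] := @smallest_eigenvalueP R n (A^T *m A) n0.
  by rewrite trmx_mul trmxK.
move=> /le_trans; apply.
set y := b^T *m A^T.
have -> : dot (b^T *m (A^T *m A)) b^T = dot y y by rewrite mulmxA dot_mulmx_adj.
(* the residual F - A b is orthogonal to A b *)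
have yF : dot y F^T = dot y y.
  by rewrite /dot /y trmxK trmx_mul !trmxK -mulmxA -bF !mulmxA.
have := dot_ge0 (F^T - y).
rewrite -scaleN1r !dotDl !dotDr !dotZl !dotZr (dotC F^T y) yF; lra.
Qed.

(** Cramer's rule for the normal equations.  Unlike a formula with [invmx], it
    depends measurably on [A] and [F] in an evident way; it vanishes when the
    Gram matrix is singular, since [0^-1 = 0]. *)
Definition normal_solution m n (A : 'M[R]_(m, n)) (F : 'cV[R]_m) : 'cV[R]_n :=
  (\det (A^T *m A))^-1 *: (\adj (A^T *m A) *m (A^T *m F)).

Lemma normal_solutionE m n (A : 'M[R]_(m, n)) (F : 'cV[R]_m) :
  A^T *m A \in unitmx ->
  invmx (A^T *m A) *m A^T *m F = normal_solution A F.
Proof. by move=> Gu; rewrite /invmx Gu -mulmxA -scalemxAl. Qed.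

(** The factor by which the solution map stretches the particular data [F]; it
    plays the role of [s1 ^ (-1/2)] while being visibly measurable in [A] and
    [F]. *)
Definition gain m n (A : 'M[R]_(m, n)) (F : 'cV[R]_m) : R :=
  euclidean_norm (normal_solution A F) / euclidean_norm F.

Lemma gain_ge0 m n (A : 'M[R]_(m, n)) (F : 'cV[R]_m) : 0 <= gain A F.
Proof. by rewrite divr_ge0// euclidean_norm_ge0. Qed.

(** When [F = 0] the solution vanishes too, so that the convention [0^-1 = 0] in
    [gain] is harmless. *)
Lemma gainE m n (A : 'M[R]_(m, n)) (F : 'cV[R]_m) :
  euclidean_norm (normal_solution A F) = gain A F * euclidean_norm F.
Proof.
have [F0|F0] := eqVneq (euclidean_norm F) 0; last by rewrite divfK.
rewrite F0 mulr0; move/eqP: F0; rewrite euclidean_norm_eq0 => /eqP ->.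
by apply/eqP; rewrite euclidean_norm_eq0 /normal_solution !mulmx0 scaler0.
Qed.

(** The inverse is taken in [\bar R], so a vanishing smallest eigenvalue makes the
    right-hand side [+oo] and the bound holds for every [A], singular or not. *)
Lemma sqr_gain_le m n (A : 'M[R]_(m, n)) (F : 'cV[R]_m) : (0 < n)%N ->
  ((gain A F ^+ 2)%:E <= (smallest_eigenvalue (A^T *m A))%:E^-1)%E.
Proof.
move=> n0; have s0 := gram_eigenvalue_ge0 A n0; set s := smallest_eigenvalue _ in s0 *.
rewrite inver; case: eqVneq => [_|sneq0]; first exact: leey.
have s1 : 0 < s by rewrite lt_def sneq0.
rewrite lee_fin; have [Gu|Gu] := boolP (A^T *m A \in unitmx); last first.
  rewrite /gain /normal_solution.
  move: Gu; rewrite unitmxE unitfE negbK => /eqP ->.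
  rewrite invr0 scale0r (_ : euclidean_norm 0 = 0) ?mul0r ?expr0n ?invr_ge0//=.
  by apply/eqP; rewrite euclidean_norm_eq0.
rewrite /gain expr_div_n; set F2 := euclidean_norm F ^+ 2.
have [->|F0] := eqVneq F2 0; first by rewrite invr0 mulr0 invr_ge0.
have F1 : 0 < F2 by rewrite lt_def F0 sqr_ge0.
rewrite ler_pdivrMr// mulrC ler_pdivlMr// mulrC.
apply: normal_equation_bound => //.
by rewrite -normal_solutionE// -(mulmxA (invmx _)) mulKVmx.
Qed.
End LeastSquares.

(** * Measurability of the least squares solution *)

Section MeasurableMatrix.
Context (R : realType) (d : measure_display) (T : measurableType d).
Local Open Scope ring_scope.

(** The formula [x * (x^2) `^ (-1)] is valid at [0] as well, and reduces the claim
    to the measurability of real powers. *)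
Lemma measurable_invr : measurable_fun [set: R] (@GRing.inv R).
Proof.
have -> : @GRing.inv R = fun x : R => x * (x ^+ 2) `^ (- 1).
  apply/funext => x; rewrite powR_inv1 ?sqr_ge0//.
  have [->|x0] := eqVneq x 0; first by rewrite mul0r invr0.
  by rewrite expr2 invfM mulrA mulfV// mul1r.
apply: measurable_funM => //.
apply: (@measurableT_comp _ _ _ _ _ _ (@powR R ^~ (- 1))) => //; exact: measurable_funX.
Qed.

Lemma measurable_sqrtr : measurable_fun [set: R] (@Num.sqrt R).
Proof. by apply: continuous_measurable_fun; exact: sqrt_continuous. Qed.

Definition measurable_mx m n (A : T -> 'M[R]_(m, n)) :=
  forall i j, measurable_fun [set: T] (fun w => A w i j).

Lemma measurable_mulmx m n p (A : T -> 'M[R]_(m, n)) (B : T -> 'M[R]_(n, p)) :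
  measurable_mx A -> measurable_mx B -> measurable_mx (fun w => A w *m B w).
Proof.
move=> mA mB i j; under eq_fun do rewrite mxE.
by apply: measurable_sum => k; exact: measurable_funM.
Qed.

Lemma measurable_trmx m n (A : T -> 'M[R]_(m, n)) :
  measurable_mx A -> measurable_mx (fun w => (A w)^T).
Proof. by move=> mA i j; under eq_fun do rewrite mxE; exact: mA. Qed.

Lemma measurable_det n (A : T -> 'M[R]_n) :
  measurable_mx A -> measurable_fun [set: T] (fun w => \det (A w)).
Proof.
move=> mA; apply: measurable_sum => s; apply: measurable_funM => //.
by apply: measurable_prod => i _; exact: mA.
Qed.

Lemma measurable_adj n (A : T -> 'M[R]_n) :
  measurable_mx A -> measurable_mx (fun w => \adj (A w)).
Proof.
move=> mA i j; under eq_fun do rewrite mxE.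
apply: measurable_funM => //; apply: measurable_det => k l.
by under eq_fun do rewrite !mxE; exact: mA.
Qed.

Lemma measurable_euclidean_norm n (v : T -> 'cV[R]_n) :
  measurable_mx v -> measurable_fun [set: T] (fun w => euclidean_norm (v w)).
Proof.
move=> mv; apply: (measurableT_comp measurable_sqrtr).
by apply: measurable_sum => i; exact/measurable_funX/mv.
Qed.

Lemma measurable_gain m n (A : T -> 'M[R]_(m, n)) (F : T -> 'cV[R]_m) :
  measurable_mx A -> measurable_mx F ->
  measurable_fun [set: T] (fun w => gain (A w) (F w)).
Proof.
move=> mA mF; have mG := measurable_mulmx (measurable_trmx mA) mA.
apply: measurable_funM; last first.
  by apply: (measurableT_comp measurable_invr); exact: measurable_euclidean_norm.
apply: measurable_euclidean_norm => i j; under eq_fun do rewrite mxE.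
apply: measurable_funM.
  by apply: (measurableT_comp measurable_invr); exact: measurable_det.
apply: measurable_mulmx; first exact: measurable_adj.
by apply: measurable_mulmx => //; exact: measurable_trmx.
Qed.
End MeasurableMatrix.

(** * Comparing integrals of functions that may fail to be measurable *)

Section Integral.
Import HBNNSimple.
Context (R : realType) (d : measure_display) (T : measurableType d).

(** The integral of a nonnegative function is the supremum of the integrals of the
    simple functions below it, so it is monotone for arbitrary functions.  The
    null set is absorbed by cutting the simple functions off outside of it.
    Here this serves to compare a measurable function with powers of [s1], and
    [beta] with measurable functions. *)
Lemma ae_ge0_le_inner_integral (mu : {measure set T -> \bar R}) (f g : T -> \bar R) :
  (forall x, 0 <= f x) -> (forall x, 0 <= g x) ->
  {ae mu, forall x, f x <= g x} ->
  \int[mu]_x f x <= \int[mu]_x g x.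
Proof.
move=> f0 g0 [N [mN muN fgN]].
rewrite ge0_integralTE//; apply: ge_ereal_sup => _ [h hf <-].
have mNC : measurable (~` N) by exact: measurableC.
rewrite -integralT_nnsfun (ge0_negligible_integral mN)//; last 2 first.
- exact/measurable_EFinP.
- by move=> x _; rewrite lee_fin.
rewrite setTD integral_nnsfun// ge0_integralTE//.
apply: ereal_sup_ubound => /=.
exists (proj_nnsfun h mNC) => [x|]; last first.
  by rewrite -mrestrict.
rewrite /= mindicE; case: (boolP (x \in ~` N)) => [|_]; last by rewrite mulr0.
rewrite inE => xN; rewrite mulr1; apply: le_trans (hf x) _.
by apply: contrapT => fg; exact/xN/fgN.
Qed.

End Integral.

(** * Lp norms on a probability space *)

Section Norms.
Context (R : realType) (d : measure_display) (T : measurableType d).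
Implicit Types (f g h : T -> R) (p q : \bar R).

Lemma Lnormy_ae (P : probability T R) f : {ae P, forall x, `|f x|%:E <= 'N[P]_(+oo)[EFin \o f]}.
Proof.
rewrite unlock /= probability_setT lte01.
exact: (@ess_sup_ge _ _ _ P (abse \o (EFin \o f))).
Qed.

Lemma Lnormy_le (P : probability T R) f y : {ae P, forall x, `|f x|%:E <= y} ->
  'N[P]_(+oo)[EFin \o f] <= y.
Proof.
by rewrite unlock /= probability_setT lte01 => /ess_supP.
Qed.

Lemma hoelder1y (P : probability T R) f g : measurable_fun [set: T] f ->
  'N[P]_1[EFin \o (f \* g)%R] <= 'N[P]_1[EFin \o f] * 'N[P]_(+oo)[EFin \o g].
Proof.
move=> mf; rewrite !Lnorm1 -ge0_integralZr//; last 2 first.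
- by apply: measurableT_comp => //; exact/measurable_EFinP.
- exact: Lnorm_ge0.
apply: ae_ge0_le_inner_integral => // [x|].
  by rewrite mule_ge0// Lnorm_ge0.
have := Lnormy_ae P g; apply: filterS => x gx /=.
by rewrite normrM EFinM lee_wpmul2l// lee_fin.
Qed.

(** Between the finite conjugate exponents and the pair [(1, +oo)] there is
    nothing else: an infinite exponent forces its conjugate to be [1]. *)
Lemma hoelder_ereal (P : probability T R) f g p q :
  measurable_fun [set: T] f -> measurable_fun [set: T] g ->
  1 <= p -> 1 <= q -> p^-1 + q^-1 = 1 ->
  'N[P]_1[EFin \o (f \* g)%R] <= 'N[P]_p[EFin \o f] * 'N[P]_q[EFin \o g].
Proof.
move=> mf mg; move: p q => [p| |] [q| |]//.
- rewrite !lee_fin => p1 q1.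
  have p0 : (0 < p)%R by exact: lt_le_trans p1.
  have q0 : (0 < q)%R by exact: lt_le_trans q1.
  by rewrite !inver !gt_eqF// => -[pq]; exact: hoelder.
- rewrite lee_fin inver invey => p1 _; rewrite adde0.
  case: ifPn => // _ [/(congr1 GRing.inv)]; rewrite invrK invr1 => ->.
  exact: hoelder1y.
- rewrite lee_fin inver invey => _ q1; rewrite add0e.
  case: ifPn => // _ [/(congr1 GRing.inv)]; rewrite invrK invr1 => ->.
  rewrite muleC; under eq_Lnorm do rewrite /= mulrC.
  exact: hoelder1y.
- by rewrite !invey adde0 => _ _ /esym/eqP; rewrite onee_eq0.
Qed.

(** With [q = r] and [s = s1^-1] the right-hand side is the square root of [K]: the
    exponents satisfy [2 / r * 1/2 = 1 / r], and [|f|^r = (f^2)^(r/2)]. *)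
Lemma Lnorm_sqr_le (P : probability T R) f (s : T -> \bar R) (r : R) : (0 < r)%R ->
  (forall x, 0 <= s x) ->
  (forall x, (f x ^+ 2)%:E <= s x) ->
  'N[P]_(r%:E)[EFin \o f] <= ((\int[P]_x (s x `^ (r / 2))) `^ (2 / r)) `^ 2^-1.
Proof.
move=> r0 s0 fs; rewrite -poweRrM.
have -> : (2 / r * 2^-1 = r^-1 :> R)%R by field; rewrite gt_eqF.
rewrite unlock; apply: gt0_ler_poweR.
- by rewrite invr_ge0 ltW.
- by rewrite in_itv/= leey andbT integral_ge0// => x _; exact: poweR_ge0.
- by rewrite in_itv/= leey andbT integral_ge0// => x _; exact: poweR_ge0.
apply: ae_ge0_le_inner_integral => [x|x|]; rewrite ?poweR_ge0//.
apply: aeW => x; rewrite [leLHS](_ : _ = (f x ^+ 2)%:E `^ (r / 2)); last first.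
  rewrite /=.
  rewrite -real_normK ?num_real//.
  by rewrite -powR_mulrn// -powRrM mulrC divfK.
apply: gt0_ler_poweR => //.
- by rewrite divr_ge0// ltW.
- by rewrite in_itv/= leey andbT lee_fin sqr_ge0.
- by rewrite in_itv/= leey andbT s0.
Qed.

Lemma Lnormy_sqr_le (P : probability T R) f (s : T -> \bar R) :
  (forall x, 0 <= s x) ->
  (forall x, (f x ^+ 2)%:E <= s x) ->
  'N[P]_(+oo)[EFin \o f] <= 'N[P]_(+oo)[s] `^ 2^-1.
Proof.
move=> s0 fs; apply: Lnormy_le.
have : {ae P, forall x, `|s x| <= 'N[P]_(+oo)[s]}.
  by rewrite unlock /= probability_setT lte01; exact: (@ess_sup_ge _ _ _ P (abse \o s)).
apply: filterS => x; rewrite gee0_abs// => /(le_trans (fs x)) fN.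
have -> : `|f x|%:E = (f x ^+ 2)%:E `^ 2^-1.
  by rewrite poweR_EFin powR12_sqrt ?sqr_ge0// sqrtr_sqr.
apply: gt0_ler_poweR => //.
- by rewrite in_itv/= leey andbT lee_fin sqr_ge0.
- by rewrite in_itv/= leey andbT Lnorm_ge0.
Qed.

End Norms.

(** The Lp norm of [f] along a random variable depends only on its law: by change
    of variables for [p] finite, and because null sets pull back to null sets for
    [p = +oo]. *)
Lemma Lnorm_distribution (R : realType) (d d' : measure_display)
    (T : measurableType d) (Omega : measurableType d')
    (P : probability T R) (mu : probability Omega R)
    (X : {RV P >-> Omega}) (f : {mfun Omega >-> R}) (p : \bar R) : 1 <= p ->
  (forall A, measurable A -> distribution P X A = mu A) ->
  'N[P]_p[EFin \o (f \o X)] <= 'N[mu]_p[EFin \o f].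
Proof.
move=> p1 Xmu.
case: p p1 => [p p1| |//].
  rewrite unlock le_eqVlt; apply/orP; left; apply/eqP; congr (_ `^ _).
  rewrite -(@eq_measure_integral _ _ _ _ mu (distribution P X)).
    rewrite ge0_integral_distribution//.
      apply: (@measurableT_comp _ _ _ _ _ _ (fun x : \bar R => x `^ p)).
        exact: measurable_poweR.
      by apply: measurableT_comp => //; exact/measurable_EFinP.
    by move=> y; exact: poweR_ge0.
  by move=> A mA _; exact: Xmu.
move=> _; apply: Lnormy_le.
have [N [mN muN fN]] := Lnormy_ae mu f.
exists (X @^-1` N); split => [||x /= fx].
- by rewrite -[_ @^-1` _]setTI; exact: measurable_funPT.
- by rewrite -muN; exact: Xmu.
- exact: fN.
Qed.

(** * The expectation bound *)

Lemma Lnorm_gain_le (R : realType) (d d' : measure_display)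
    (Omega : measurableType d) (T : measurableType d') (P : probability T R)
    (n m : nat) (q : \bar R)
    (f : {mfun Omega >-> R}) (gamma : 'I_n -> {mfun Omega >-> R})
    (X : 'I_m -> {RV P >-> Omega}) :
  (0 < n)%N -> 1 <= q ->
  'N[P]_q[EFin \o (fun w => gain (sampleGamma gamma X w) (sampleF f X w))]
    <= K P q gamma X `^ 2^-1.
Proof.
move=> n0 q1; set h := fun w => gain _ _.
pose s w : \bar R := (s1 gamma X w)%:E^-1.
have s0 w : 0 <= s w by rewrite inve_ge0 lee_fin gram_eigenvalue_ge0.
have hs w : (h w ^+ 2)%:E <= s w by exact: sqr_gain_le.
case: q q1 => [r| |//].
  by rewrite lee_fin => r1; apply: Lnorm_sqr_le => //; exact: lt_le_trans r1.
by move=> _; exact: Lnormy_sqr_le.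
Qed.

Theorem corollary3p3 (R : realType) :
  exists c : nat -> R -> R -> R,
    forall (d d' : measure_display)
      (Omega : measurableType d) (mu : probability Omega R)
      (T : measurableType d') (P : probability T R)
      (n m : nat) (C : R) (p q : \bar R)
      (f : {mfun Omega >-> R}) (gamma : 'I_n -> {mfun Omega >-> R})
      (X : 'I_m -> {RV P >-> Omega}),
    (0 < n)%N -> (0 < m)%N ->
    iid mu X ->
    {ae P, forall w, gram gamma X w \in unitmx} ->
    (m%:R <= C * n%:R)%R ->
    1 <= p -> 1 <= q -> q^-1 + p^-1 = 1 ->
    finite_norm mu p f ->
    K P q gamma X < +oo ->
    'E_P[(fun w => euclidean_norm (beta f gamma X w))]
      <= (c n C (fine (K P q gamma X)))%:E * 'N[mu]_p[EFin \o f].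
Proof.
exists (fun n C k => C * n%:R * Num.sqrt k)%R.
move=> d d' Omega mu T P n m C p q f gamma X n0 _ [_ Xmu] invG mCn p1 q1 pq _ Kfin.
pose h w := gain (sampleGamma gamma X w) (sampleF f X w).
have mfX i : measurable_fun [set: T] (f \o X i).
  by apply: measurableT_comp => //; exact: measurable_funPT.
have mh : measurable_fun [set: T] h.
  apply: measurable_gain => i j; under eq_fun do rewrite mxE.
    by apply: measurableT_comp => //; exact: measurable_funPT.
  exact: mfX.
have K0 : 0 <= K P q gamma X.
  rewrite /K; case: (q) q1 => [r _| _|//]; first exact: poweR_ge0.
  exact: Lnorm_ge0.
have hK : 'N[P]_q[EFin \o h] <= (Num.sqrt (fine (K P q gamma X)))%:E.
  have gK := Lnorm_gain_le f gamma X n0 q1; apply: (le_trans gK).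
  rewrite -[X in X `^ _]fineK ?ge0_fin_numE// poweR_EFin.
  by rewrite powR12_sqrt ?fine_ge0.
rewrite unlock.
apply: (@le_trans _ _ (\int[P]_w \sum_(i < m) `|(h w * f (X i w))%:E|)).
  apply: ae_ge0_le_inner_integral => [w|w|].
  - by rewrite lee_fin euclidean_norm_ge0.
  - by rewrite sume_ge0.
  move: invG; apply: filterS => w Gw.
  rewrite /beta normal_solutionE// gainE -/(h w) sumEFin lee_fin.
  under eq_bigr do rewrite normrM.
  rewrite -mulr_sumr ger0_norm ?gain_ge0// ler_wpM2l ?gain_ge0//.
  apply: le_trans (euclidean_norm_le_sum _) _.
  by apply: ler_sum => i _; rewrite mxE.
rewrite ge0_integral_sum//; last first.
  move=> i; apply/measurable_EFinP/measurableT_comp => //.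
  exact: (measurable_funM mh (mfX i)).
apply: (@le_trans _ _ (\sum_(i < m)
    (Num.sqrt (fine (K P q gamma X)))%:E * 'N[mu]_p[EFin \o f])).
  apply: lee_sum => i _; rewrite -(Lnorm1 P (EFin \o (h \* (f \o X i))%R)).
  apply: le_trans (hoelder_ereal P mh (mfX i) q1 p1 pq) _.
  apply: lee_pmul; rewrite ?Lnorm_ge0//.
  by apply: Lnorm_distribution => //; exact: Xmu.
rewrite -ge0_sume_distrl; last by move=> i _; rewrite lee_fin sqrtr_ge0.
rewrite sumEFin sumr_const card_ord -[(_ *+ m)%R]mulr_natl.
rewrite lee_wpmul2r ?Lnorm_ge0// lee_fin.
by rewrite ler_wpM2r// sqrtr_ge0.
Qed.
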